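(* Let $\mathcal S\subset\mathbb H^1$ be an oriented $C^2$ surface in the Heisenberg group with characteristic set $\Sigma_{\mathcal S}$. On $\mathcal S\setminus\Sigma_{\mathcal S}$ the pseudo-hermitian mean curvature $H^{p.h.}$ of $\mathcal S$ coincides, up to the choice of orientation (i.e. up to sign), with the $H$-mean curvature $\mathcal H$ of $\mathcal S$.
   Context: $\mathbb H^1=\mathbb R^3$ with group law $(x,y,t)(x',y',t')=(x+x',y+y',t+t'+\frac12(xy'-x'y))$ and left-invariant fields $X_1=\partial_x-\frac y2\partial_t$, $X_2=\partial_y+\frac x2\partial_t$, $T=\partial_t$; $\langle\cdot,\cdot\rangle$ is the Riemannian metric making $\{X_1,X_2,T\}$ orthonormal, $\nabla$ its Levi-Civita connection; the horizontal bundle $H\mathbb H^1$ is spanned by $X_1,X_2$. With $\boldsymbol N$ a non-unit normal to $\mathcal S$, $p=\langle\boldsymbol N,X_1\rangle$, $q=\langle\boldsymbol N,X_2\rangle$, $W=\sqrt{p^2+q^2}$, $\Sigma_{\mathcal S}=\{W=0\}$; off $\Sigma_{\mathcal S}$, $\bar p=p/W$, $\bar q=q/W$, $\nu^H=\bar pX_1+\bar qX_2$, and $\mathcal H=-\langle\nabla_{\boldsymbol e}\boldsymbol e,\nu^H\rangle$ with $\boldsymbol e=\bar qX_1-\bar pX_2$. $HT\mathcal S$ denotes the line bundle over $\mathcal S\setminus\Sigma_{\mathcal S}$ with fiber $T_g\mathcal S\cap H_g\mathbb H^1$. Pseudo-hermitian mean curvature: $\mathbb H^1$ is viewed as a CR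 manifold with CR structure $J$ on $H\mathbb H^1$, $JX_1=X_2$, $JX_2=-X_1$, and contact form $\Theta$ with kernel $H\mathbb H^1$, normalized so that $\{X_1,X_2\}$ is orthonormal for the metric $\frac12d\Theta(\cdot,J\cdot)$. $\nabla^{p.h.}$ is the associated pseudo-hermitian (Tanaka–Webster) connection. Given a unit field $\boldsymbol e_1\in HT\mathcal S$ and $\boldsymbol e_2=J\boldsymbol e_1$, $H^{p.h.}$ is the function on $\mathcal S\setminus\Sigma_{\mathcal S}$ with $\nabla^{p.h.}_{\boldsymbol e_1}\boldsymbol e_1=H^{p.h.}\boldsymbol e_2$. *)

(* Defs.v *)
From HB Require Import structures.
From mathcomp Require Import all_boot all_order all_algebra.
From mathcomp Require Import all_classical all_reals all_analysis.
From mathcomp Require Import ring.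
Import Order.TTheory GRing.Theory Num.Theory numFieldNormedType.Exports.

Set Implicit Arguments.
Unset Strict Implicit.
Unset Printing Implicit Defensive.

Local Open Scope classical_set_scope.
Local Open Scope ring_scope.

(* Points of H^1 = R^3 are rows (x, y, t).  All tangent spaces are identified
   with R^3 through the coordinate fields d/dx, d/dy, d/dt, so a tangent vector
   is again a row, and a vector field is a map from rows to rows. *)

Section Regularity.
Context {R : realType} {V W : normedModType R}.

(* Meant for open U. *)
Fixpoint Ck_on (k : nat) (U : set V) (f : V -> W) : Prop :=
  match k with
  | 0%N => forall x, U x -> {for x, continuous f}
  | k'.+1 => (forall x, U x -> differentiable f x) /\
             (forall v : V, Ck_on k' U ('D_v f))
  end.

Definition Ck_near (k : nat) (g : V) (f : V -> W) : Prop :=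
  exists U : set V, [/\ open U, U g & Ck_on k U f].

Definition smooth (f : V -> W) : Prop := forall k, Ck_on k setT f.

(* F is a C^1 extension, to a neighbourhood of g, of the map f given on A. *)
Definition C1_extension (A : set V) (f : V -> W) (g : V) (F : V -> W) : Prop :=
  Ck_near 1 g F /\ (\forall x \near g, A x -> F x = f x).

Definition C1_along (A : set V) (f : V -> W) : Prop :=
  forall g, A g -> exists F, C1_extension A f g F.

End Regularity.

Section Heisenberg.
Context {R : realType}.
Notation pt := 'rV[R]_3.

Definition row3 (a b c : R) : pt := \row_(j < 3) nth 0 [:: a; b; c] j.

Definition X1 (g : pt) : pt := row3 1 0 (- (g 0 1 / 2)).
Definition X2 (g : pt) : pt := row3 0 1 (g 0 0 / 2).
Definition T (g : pt) : pt := row3 0 0 1.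

Definition horizontal (g v : pt) : Prop :=
  exists a b : R, v = a *: X1 g + b *: X2 g.

(* The T-coordinate of v in the frame X1, X2, T at g; its X1- and
   X2-coordinates are v 0 0 and v 0 1 (see frame_decomposition). *)
Definition tcoord (g v : pt) : R :=
  v 0 2 + (g 0 1 * v 0 0 - g 0 0 * v 0 1) / 2.

Definition metric (g u v : pt) : R :=
  u 0 0 * v 0 0 + u 0 1 * v 0 1 + tcoord g u * tcoord g v.

(* Extended to the whole tangent space by J T = 0. *)
Definition J (g v : pt) : pt := v 0 0 *: X2 g - v 0 1 *: X1 g.

Lemma frame_decomposition (g v : pt) :
  v = v 0 0 *: X1 g + v 0 1 *: X2 g + tcoord g v *: T g.
Proof.
apply/rowP => j; rewrite !mxE /tcoord.
case: j => [[|[|[|//]]] lj] /=.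
- by rewrite (_ : Ordinal lj = 0) ?mulr1 ?mulr0 ?addr0 //; apply: val_inj.
- by rewrite (_ : Ordinal lj = 1) ?mulr1 ?mulr0 ?addr0 ?add0r //; apply: val_inj.
- rewrite (_ : Ordinal lj = 2); last exact: val_inj.
  ring.
Qed.

Lemma metric_orthonormal (g : pt) :
  [/\ metric g (X1 g) (X1 g) = 1, metric g (X2 g) (X2 g) = 1 &
      metric g (T g) (T g) = 1] /\
  [/\ metric g (X1 g) (X2 g) = 0, metric g (X1 g) (T g) = 0 &
      metric g (X2 g) (T g) = 0].
Proof.
by rewrite /metric /tcoord !mxE /= !(mulr1, mulr0, mul0r, addr0, add0r, subr0,
  sub0r, mulNr, addNr, subrr).
Qed.

Lemma J_frame (g : pt) : [/\ J g (X1 g) = X2 g, J g (X2 g) = - X1 g & J g (T g) = 0].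
Proof. by rewrite /J !mxE /= !scale1r !scale0r subr0 sub0r subrr. Qed.

Definition bracket (U V : pt -> pt) (g : pt) : pt :=
  'D_(U g) V g - 'D_(V g) U g.

(* [nabla g v Y] is the covariant derivative at g of the field Y in the
   direction of the tangent vector v.  The operator is applied to fields that
   are C^1 near g, to which a connection on smooth fields extends uniquely;
   its values on other fields are irrelevant. *)
Definition covderiv := pt -> pt -> (pt -> pt) -> pt.

Record is_connection (nabla : covderiv) : Prop := {
  connection_smooth : forall V Y : pt -> pt, smooth V -> smooth Y ->
    smooth (fun g => nabla g (V g) Y);
  connection_linear : forall g (a : R) u v Y, Ck_near 1 g Y ->
    nabla g (a *: u + v) Y = a *: nabla g u Y + nabla g v Y;
  connection_additive : forall g v Y Z, Ck_near 1 g Y -> Ck_near 1 g Z ->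
    nabla g v (fun x => Y x + Z x) = nabla g v Y + nabla g v Z;
  connection_leibniz : forall g v (f : pt -> R) Y,
    Ck_near 1 g f -> Ck_near 1 g Y ->
    nabla g v (fun x => f x *: Y x) = 'D_v f g *: Y g + f g *: nabla g v Y
}.

Definition torsion (nabla : covderiv) (U V : pt -> pt) (g : pt) : pt :=
  nabla g (U g) V - nabla g (V g) U - bracket U V g.

Record is_levi_civita (nabla : covderiv) : Prop := {
  levi_civita_connection : is_connection nabla;
  levi_civita_torsion : forall g U V, Ck_near 1 g U -> Ck_near 1 g V ->
    torsion nabla U V g = 0;
  levi_civita_metric : forall g v Y Z, Ck_near 1 g Y -> Ck_near 1 g Z ->
    'D_v (fun x => metric x (Y x) (Z x)) g =
      metric g (nabla g v Y) (Z g) + metric g (Y g) (nabla g v Z)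
}.

(* A 1-form is a field of columns (its components in dx, dy, dt). *)
Definition pairing (w : 'cV[R]_3) (v : pt) : R := (v *m w) 0 0.

(* Convention: d Theta(U, V) = U Theta(V) - V Theta(U) - Theta([U, V]), with no
   factor 1/2; this is its value on vectors extended with constant components. *)
Definition dform (Theta : pt -> 'cV[R]_3) (g u v : pt) : R :=
  pairing ('D_u Theta g) v - pairing ('D_v Theta g) u.

Definition levi (Theta : pt -> 'cV[R]_3) (g u v : pt) : R :=
  dform Theta g u (J g v) / 2.

Record is_contact_form (Theta : pt -> 'cV[R]_3) : Prop := {
  contact_smooth : smooth Theta;
  contact_kernel : forall g v, pairing (Theta g) v = 0 <-> horizontal g v;
  contact_normalized : forall g,
    [/\ levi Theta g (X1 g) (X1 g) = 1, levi Theta g (X2 g) (X2 g) = 1,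
        levi Theta g (X1 g) (X2 g) = 0 & levi Theta g (X2 g) (X1 g) = 0]
}.

Definition is_reeb (Theta : pt -> 'cV[R]_3) (xi : pt -> pt) : Prop :=
  forall g, pairing (Theta g) (xi g) = 1 /\
            (forall v, dform Theta g (xi g) v = 0).

Definition C1_horizontal_near (g : pt) (Y : pt -> pt) : Prop :=
  Ck_near 1 g Y /\ (\forall x \near g, horizontal x (Y x)).

(* The real form of the axioms of the Tanaka-Webster connection: the horizontal
   bundle, J, the Levi metric and the Reeb field are parallel, and the torsion
   is pure. *)
Record is_tanaka_webster_for (Theta : pt -> 'cV[R]_3) (xi : pt -> pt)
    (nabla : covderiv) : Prop := {
  tw_connection : is_connection nabla;
  tw_horizontal : forall g v Y, C1_horizontal_near g Y ->
    horizontal g (nabla g v Y);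
  tw_reeb : forall g v, nabla g v xi = 0;
  tw_J : forall g v Y, C1_horizontal_near g Y ->
    nabla g v (fun x => J x (Y x)) = J g (nabla g v Y);
  tw_levi : forall g v Y Z,
    C1_horizontal_near g Y -> C1_horizontal_near g Z ->
    'D_v (fun x => levi Theta x (Y x) (Z x)) g =
      levi Theta g (nabla g v Y) (Z g) + levi Theta g (Y g) (nabla g v Z);
  tw_torsion_horizontal : forall g U V,
    C1_horizontal_near g U -> C1_horizontal_near g V ->
    torsion nabla U V g = dform Theta g (U g) (V g) *: xi g;
  tw_torsion_reeb : forall g U, C1_horizontal_near g U ->
    torsion nabla xi (fun x => J x (U x)) g = - J g (torsion nabla xi U g)
}.

Definition is_tanaka_webster (Theta : pt -> 'cV[R]_3) (nabla : covderiv) :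
    Prop :=
  exists2 xi, is_reeb Theta xi & is_tanaka_webster_for Theta xi nabla.

Definition C2_surface (S : set pt) : Prop :=
  forall g, S g -> exists (U : set pt) (phi : pt -> R),
    [/\ open U, U g, Ck_on 2 U phi,
        (forall x, U x -> exists v, 'D_v phi x != 0) &
        (forall x, U x -> (S x <-> phi x = 0))].

Definition tangent (S : set pt) (g v : pt) : Prop :=
  exists gamma : R -> pt,
    [/\ gamma 0 = g, (\forall s \near (0 : R), S (gamma s)) &
        is_derive (0 : R) (1 : R) gamma v].

(* N orients S; it need not have unit length. *)
Record is_normal (S : set pt) (N : pt -> pt) : Prop := {
  normal_C1 : C1_along S N;
  normal_neq0 : forall g, S g -> N g != 0;
  normal_orthogonal : forall g v, tangent S g v -> metric g (N g) v = 0
}.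

Section Surface.
Context (S : set pt) (N : pt -> pt).

Definition p (g : pt) : R := metric g (N g) (X1 g).
Definition q (g : pt) : R := metric g (N g) (X2 g).
Definition W (g : pt) : R := Num.sqrt (p g ^+ 2 + q g ^+ 2).

Definition characteristic : set pt := [set g | S g /\ W g = 0].
Definition noncharacteristic : set pt := S `\` characteristic.

Definition pbar (g : pt) : R := p g / W g.
Definition qbar (g : pt) : R := q g / W g.
Definition nuH (g : pt) : pt := pbar g *: X1 g + qbar g *: X2 g.
Definition e (g : pt) : pt := qbar g *: X1 g - pbar g *: X2 g.

(* Covariant derivative, in a direction v tangent to A, of a field Y defined
   only along A: it does not depend on the C^1 extension of Y. *)
Definition cov_along (nabla : covderiv) (A : set pt) (Y : pt -> pt)
    (g v : pt) : pt :=
  xget 0 [set w | exists F, C1_extension A Y g F /\ w = nabla g v F].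

(* nabla is meant to be the Levi-Civita connection. *)
Definition H_mean_curvature (nabla : covderiv) (g : pt) : R :=
  - metric g (cov_along nabla noncharacteristic e g (e g)) (nuH g).

Record is_unit_section (Theta : pt -> 'cV[R]_3) (e1 : pt -> pt) : Prop := {
  section_C1 : C1_along noncharacteristic e1;
  section_HTS : forall g, noncharacteristic g ->
    tangent S g (e1 g) /\ horizontal g (e1 g);
  section_unit : forall g, noncharacteristic g ->
    levi Theta g (e1 g) (e1 g) = 1
}.

(* nabla is meant to be the Tanaka-Webster connection. *)
Definition is_ph_mean_curvature (nabla : covderiv) (e1 : pt -> pt)
    (Hph : pt -> R) : Prop :=
  forall g, noncharacteristic g ->
    cov_along nabla noncharacteristic e1 g (e1 g) = Hph g *: J g (e1 g).

End Surface.

(* A sign on A, constant near each point of A. *)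
Definition locally_constant_sign (A : set pt) (s : pt -> R) : Prop :=
  forall g, A g -> (s g = 1 \/ s g = -1) /\
    (\forall x \near g, A x -> s x = s g).

End Heisenberg.

(* Main.v *)
(* Both connections kill the frame X1, X2 in horizontal directions, up to T:
   this is Koszul's argument, since the frame is orthonormal and, for both
   connections, nabla_X1 X2 - nabla_X2 X1 is vertical (for the pseudo-hermitian
   one because Theta = -2 (dt + (y dx - x dy) / 2), so that the Reeb field is
   -T / 2).
   Hence, for a field that is horizontal along the surface, the horizontal part of
   either covariant derivative along a horizontal tangent vector is the
   coordinatewise derivative of its X1- and X2-components; curves in the
   surface show that it does not depend on the extension of the field.
   Finally e1 = +-e, with a sign that is locally constant by continuity, and
   rotating by J turns one definition of the curvature into the other. *)
Require Import Defs.
From mathcomp Require Import all_boot all_order all_algebra.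
From mathcomp Require Import all_classical all_reals all_analysis.
From mathcomp Require Import ring lra.
Import Order.TTheory GRing.Theory Num.Theory numFieldNormedType.Exports.

Set Implicit Arguments.
Unset Strict Implicit.

Local Open Scope classical_set_scope.
Local Open Scope ring_scope.

(** * Closure properties of C^1 maps, entry by entry for rows and matrices *)

Section C1Maps.
Context {R : realType} {V : normedModType R}.
Implicit Types (f h : V -> R) (x g : V) (U : set V).

Lemma differentiable_row n (F : V -> 'rV[R]_n) x :
  (forall j, differentiable (fun y => F y 0 j) x) -> differentiable F x.
Proof.
move=> dF; rewrite (_ : F = \sum_j (fun y => F y 0 j *: delta_mx 0 j)).
  by apply: differentiable_sum => j; exact: differentiableZl.
by apply/funext => y; rewrite fct_sumE [LHS]row_sum_delta.
Qed.

Lemma differentiable_entry m n (F : V -> 'M[R]_(m, n)) x i j :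
  differentiable F x -> differentiable (fun y => F y i j) x.
Proof.
move=> dF.
apply: (@differentiable_comp _ _ _ _ F (fun M : 'M[R]_(m, n) => M i j)) => //.
exact: differentiable_coord.
Qed.

Lemma derive_entry m n (F : V -> 'M[R]_(m, n)) x v i j :
  differentiable F x -> ('D_v F x) i j = 'D_v (fun y => F y i j) x.
Proof. by move=> dF; rewrite derive_mx ?mxE//; exact: diff_derivable. Qed.

Lemma continuous_row n (F : V -> 'rV[R]_n) x :
  (forall j, {for x, continuous (fun y => F y 0 j)}) ->
  {for x, continuous F}.
Proof.
move=> cF; rewrite (_ : F = fun y => \sum_j F y 0 j *: delta_mx 0 j).
  apply: cvg_big => [|j _]; first exact: add_continuous.
  by apply: cvgZr_tmp; exact: cF.
by apply/funext => y; rewrite [LHS]row_sum_delta.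
Qed.

Lemma continuous_entry m n (F : V -> 'M[R]_(m, n)) x i j :
  {for x, continuous F} -> {for x, continuous (fun y => F y i j)}.
Proof.
move=> cF; apply: (@continuous_comp _ _ _ F (fun M : 'M[R]_(m, n) => M i j)) => //.
exact: coord_continuous.
Qed.

(** Differentiation rules hold only at points of [U]; this carries continuity from the resulting
    formula over to the directional derivative itself. *)
Lemma continuous_open_eq {Y : normedModType R} U (F G : V -> Y) x :
  open U -> U x -> (forall y, U y -> F y = G y) ->
  {for x, continuous F} -> {for x, continuous G}.
Proof.
move=> oU Ux FG; rewrite /prop_for /continuous_at (FG _ Ux) => cF.
apply: cvg_trans cF; apply: near_eq_cvg.
by apply: filterS (open_nbhs_nbhs (conj oU Ux)) => y /FG.
Qed.

Lemma Ck_on1_sub {Y : normedModType R} U U' (F : V -> Y) :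
  U `<=` U' -> Ck_on 1 U' F -> Ck_on 1 U F.
Proof. by move=> UU' [dF cF]; split=> [x|v x] /UU'; [exact: dF|exact: cF]. Qed.

Lemma Ck_on1D {Y : normedModType R} U (F G : V -> Y) : open U ->
  Ck_on 1 U F -> Ck_on 1 U G -> Ck_on 1 U (fun x => F x + G x).
Proof.
move=> oU [dF cF] [dG cG]; split=> [x Ux|v x Ux].
  by apply: differentiableD; auto.
apply: (@continuous_open_eq _ U (fun y => 'D_v F y + 'D_v G y)) => //.
  by move=> y Uy; rewrite -deriveD//; apply: diff_derivable; auto.
by apply: continuousD; [exact: cF|exact: cG].
Qed.

Lemma Ck_on1M U f h : open U ->
  Ck_on 1 U f -> Ck_on 1 U h -> Ck_on 1 U (fun x => f x * h x).
Proof.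
move=> oU [df cf] [dh ch]; split=> [x Ux|v x Ux].
  by apply: differentiableM; auto.
apply: (@continuous_open_eq _ U
    (fun y => f y * 'D_v h y + h y * 'D_v f y)) => //.
  by move=> y Uy; rewrite -[LHS]deriveM//; apply: diff_derivable; auto.
apply: continuousD; apply: continuousM.
- exact/differentiable_continuous/df.
- exact: ch.
- exact/differentiable_continuous/dh.
- exact: cf.
Qed.

Lemma Ck_on1_entry m n (F : V -> 'M[R]_(m, n)) U i j : open U ->
  Ck_on 1 U F -> Ck_on 1 U (fun x => F x i j).
Proof.
move=> oU [dF cF]; split=> [x Ux|v x Ux]; first exact/differentiable_entry/dF.
apply: (@continuous_open_eq _ U (fun y => ('D_v F y) i j)) => //.
  by move=> y Uy; rewrite derive_entry//; exact: dF.
exact/continuous_entry/cF.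
Qed.

Lemma Ck_on1_row n (F : V -> 'rV[R]_n) U : open U ->
  (forall j, Ck_on 1 U (fun x => F x 0 j)) -> Ck_on 1 U F.
Proof.
move=> oU F1; have dF x : U x -> differentiable F x.
  by move=> Ux; apply: differentiable_row => j; exact: (F1 j).1.
split=> [//|v x Ux]; apply: continuous_row => j.
apply: (@continuous_open_eq _ U ('D_v (fun y => F y 0 j))) => //.
  by move=> y Uy; rewrite derive_entry//; exact: dF.
exact: (F1 j).2.
Qed.

Lemma Ck_near1_cst {Y : normedModType R} (c : Y) g : Ck_near 1 g (fun=> c).
Proof.
exists setT; split; [exact: openT|by []|split=> [x _|v x _]].
  exact: differentiable_cst.
rewrite (_ : 'D_v _ = cst 0); last by apply/funext => y; exact: derive_cst.
exact: cst_continuous.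
Qed.

Lemma Ck_near1D {Y : normedModType R} (F G : V -> Y) g :
  Ck_near 1 g F -> Ck_near 1 g G -> Ck_near 1 g (fun x => F x + G x).
Proof.
move=> [U [oU Ug U1]] [U' [oU' U'g U'1]]; exists (U `&` U').
split; [exact: openI|by []|apply: Ck_on1D; first exact: openI].
- by apply: Ck_on1_sub U1; exact: subIsetl.
- by apply: Ck_on1_sub U'1; exact: subIsetr.
Qed.

Lemma Ck_near1M f h g :
  Ck_near 1 g f -> Ck_near 1 g h -> Ck_near 1 g (fun x => f x * h x).
Proof.
move=> [U [oU Ug U1]] [U' [oU' U'g U'1]]; exists (U `&` U').
split; [exact: openI|by []|apply: Ck_on1M; first exact: openI].
- by apply: Ck_on1_sub U1; exact: subIsetl.
- by apply: Ck_on1_sub U'1; exact: subIsetr.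
Qed.

Lemma Ck_near1_entry m n (F : V -> 'M[R]_(m, n)) g i j :
  Ck_near 1 g F -> Ck_near 1 g (fun x => F x i j).
Proof. by move=> [U [oU Ug U1]]; exists U; split=> //; exact: Ck_on1_entry. Qed.

Lemma Ck_near1_row n (F : V -> 'rV[R]_n) g :
  (forall j, Ck_near 1 g (fun x => F x 0 j)) -> Ck_near 1 g F.
Proof.
(* Each entry is C^1 on its own neighbourhood. [D] is a pointwise condition, so the finitely many
   neighbourhoods can be intersected by [filter_forall] before an open set is extracted. *)
move=> F1; pose D x := forall j, differentiable (fun y => F y 0 j) x /\
  forall v, {for x, continuous ('D_v (fun y => F y 0 j))}.
have : \forall x \near g, D x.
  apply: filter_forall => j; have [U [oU Ug [dU cU]]] := F1 j.
  by apply: filterS (open_nbhs_nbhs (conj oU Ug)) => x Ux; split=> [|v]; auto.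
rewrite /prop_near1 nbhsE => -[U [oU Ug] UD]; exists U; split=> //.
by apply: Ck_on1_row => // j; split=> [x|v x] /UD/(_ j)[].
Qed.

Lemma Ck_near1Z n f (F : V -> 'rV[R]_n) g :
  Ck_near 1 g f -> Ck_near 1 g F -> Ck_near 1 g (fun x => f x *: F x).
Proof.
move=> f1 F1; apply: Ck_near1_row => j.
rewrite (_ : (fun x => _) = fun x => f x * F x 0 j).
  by apply: Ck_near1M; [exact: f1|exact: Ck_near1_entry].
by apply/funext => x; rewrite mxE.
Qed.

Lemma Ck_near1_differentiable {Y : normedModType R} (F : V -> Y) g :
  Ck_near 1 g F -> differentiable F g.
Proof. by case=> U [_ Ug [dF _]]; exact: dF. Qed.

End C1Maps.

(** * Coordinate functions on the space of rows *)

Section RowSpace.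
Context {R : realType} {n : nat}.

Lemma derive_coord (g v : 'rV[R]_n) i :
  'D_v (fun x : 'rV[R]_n => x 0 i) g = v 0 i.
Proof.
by rewrite -(@derive_entry _ _ _ _ id) ?derive_id.
Qed.

Lemma Ck_near1_coord (g : 'rV[R]_n) i :
  Ck_near 1 g (fun x : 'rV[R]_n => x 0 i).
Proof.
exists setT; split; [exact: openT|by []|split=> [x _|v x _]].
  exact: differentiable_coord.
rewrite (_ : 'D_v _ = cst (v 0 i)); last first.
  by apply/funext => y; exact: derive_coord.
exact: cst_continuous.
Qed.

End RowSpace.

(** * The horizontal frame [X1], [X2] in coordinates *)

Section Frame.
Context {R : realType}.
Notation pt := 'rV[R]_3.
Implicit Types (g u v x : pt) (a b c : R).

Lemma row3_entries a b c :
  [/\ row3 a b c 0 0 = a, row3 a b c 0 1 = b & row3 a b c 0 2 = c].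
Proof. by rewrite !mxE. Qed.

Lemma X1_entries g : [/\ X1 g 0 0 = 1, X1 g 0 1 = 0 & X1 g 0 2 = - (g 0 1 / 2)].
Proof. exact: row3_entries. Qed.

Lemma X2_entries g : [/\ X2 g 0 0 = 0, X2 g 0 1 = 1 & X2 g 0 2 = g 0 0 / 2].
Proof. exact: row3_entries. Qed.

Lemma ord3P (P : 'I_3 -> Prop) : P 0 -> P 1 -> P 2 -> forall j, P j.
Proof.
move=> P0 P1 P2 [[|[|[|//]]] lj].
- by rewrite (_ : Ordinal lj = 0)//; exact: val_inj.
- by rewrite (_ : Ordinal lj = 1)//; exact: val_inj.
- by rewrite (_ : Ordinal lj = 2)//; exact: val_inj.
Qed.

Lemma row3P u v : u 0 0 = v 0 0 -> u 0 1 = v 0 1 -> u 0 2 = v 0 2 -> u = v.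
Proof. by move=> ? ? ?; apply/rowP; elim/ord3P. Qed.

(** Turns an existential into an equation between smooth expressions, which can be
    differentiated. *)
Lemma horizontalE g v : horizontal g v <-> tcoord g v = 0.
Proof.
split=> [[a [b ->]]|v0].
  by rewrite /tcoord !mxE/=; field.
by exists (v 0 0), (v 0 1); rewrite {1}(frame_decomposition g v) v0 scale0r addr0.
Qed.

Lemma horizontal_decomposition g v :
  horizontal g v -> v = v 0 0 *: X1 g + v 0 1 *: X2 g.
Proof.
by move=> /horizontalE v0; rewrite {1}(frame_decomposition g v) v0 scale0r addr0.
Qed.

Lemma metric_horizontal g u v :
  horizontal g v -> metric g u v = u 0 0 * v 0 0 + u 0 1 * v 0 1.
Proof. by move=> /horizontalE v0; rewrite /metric v0 mulr0 addr0. Qed.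

Lemma horizontal_X1 g : horizontal g (X1 g).
Proof. by exists 1, 0; rewrite scale1r scale0r addr0. Qed.

Lemma horizontal_X2 g : horizontal g (X2 g).
Proof. by exists 0, 1; rewrite scale1r scale0r add0r. Qed.

Lemma J_entries g v : J g v 0 0 = - v 0 1 /\ J g v 0 1 = v 0 0.
Proof. by rewrite /J !mxE/=; split; ring. Qed.

Lemma Ck_near1_X1 g : Ck_near 1 g (@X1 R).
Proof.
apply: Ck_near1_row; elim/ord3P.
- rewrite (_ : (fun x => _) = fun=> 1); first exact: Ck_near1_cst.
  by apply/funext => x; have [] := X1_entries x.
- rewrite (_ : (fun x => _) = fun=> 0); first exact: Ck_near1_cst.
  by apply/funext => x; have [] := X1_entries x.
- rewrite (_ : (fun x => _) = fun x : pt => x 0 1 * (- 2^-1)).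
    apply: Ck_near1M; [exact: Ck_near1_coord|exact: Ck_near1_cst].
  by apply/funext => x; have [_ _ ->] := X1_entries x; ring.
Qed.

Lemma Ck_near1_X2 g : Ck_near 1 g (@X2 R).
Proof.
apply: Ck_near1_row; elim/ord3P.
- rewrite (_ : (fun x => _) = fun=> 0); first exact: Ck_near1_cst.
  by apply/funext => x; have [] := X2_entries x.
- rewrite (_ : (fun x => _) = fun=> 1); first exact: Ck_near1_cst.
  by apply/funext => x; have [] := X2_entries x.
- rewrite (_ : (fun x => _) = fun x : pt => x 0 0 * 2^-1).
    apply: Ck_near1M; [exact: Ck_near1_coord|exact: Ck_near1_cst].
  by apply/funext => x; have [_ _ ->] := X2_entries x.
Qed.

Lemma derive_X1 g v : 'D_v (@X1 R) g = - (v 0 1 / 2) *: T g.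
Proof.
have dX := Ck_near1_differentiable (Ck_near1_X1 g).
apply: row3P; rewrite (derive_entry _ _ _ dX) !mxE/=.
- rewrite mulr0 (_ : (fun x => _) = fun=> 1) ?derive_cst//.
  by apply/funext => x; have [] := X1_entries x.
- rewrite mulr0 (_ : (fun x => _) = fun=> 0) ?derive_cst//.
  by apply/funext => x; have [] := X1_entries x.
- rewrite (_ : (fun x => _) = (- 2^-1) \*: (fun x : pt => x 0 1)); last first.
    apply/funext => x; have [_ _ ->] := X1_entries x; rewrite /= /GRing.scale/=; ring.
  rewrite deriveZ ?derive_coord; last exact/diff_derivable/differentiable_coord.
  by rewrite /GRing.scale/=; ring.
Qed.

Lemma derive_X2 g v : 'D_v (@X2 R) g = (v 0 0 / 2) *: T g.
Proof.
have dX := Ck_near1_differentiable (Ck_near1_X2 g).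
apply: row3P; rewrite (derive_entry _ _ _ dX) !mxE/=.
- rewrite mulr0 (_ : (fun x => _) = fun=> 0) ?derive_cst//.
  by apply/funext => x; have [] := X2_entries x.
- rewrite mulr0 (_ : (fun x => _) = fun=> 1) ?derive_cst//.
  by apply/funext => x; have [] := X2_entries x.
- rewrite (_ : (fun x => _) = (2^-1) \*: (fun x : pt => x 0 0)); last first.
    apply/funext => x; have [_ _ ->] := X2_entries x; rewrite /= /GRing.scale/=; ring.
  rewrite deriveZ ?derive_coord; last exact/diff_derivable/differentiable_coord.
  by rewrite /GRing.scale/=; ring.
Qed.

(** Each of the two directional derivatives contributes [T / 2]. That the bracket is vertical is
    what keeps it out of the horizontal part of the torsion. *)
Lemma bracket_X1_X2 g : bracket (@X1 R) (@X2 R) g = T g.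
Proof.
rewrite /bracket derive_X1 derive_X2.
have [-> _ _] := X1_entries g; have [_ -> _] := X2_entries g.
by rewrite scaleNr opprK -scalerDl -splitr scale1r.
Qed.

End Frame.

(** * The normalized contact form, its Levi form and its Reeb field *)

Section Contact.
Context {R : realType} (Theta : 'rV[R]_3 -> 'cV[R]_3).
Hypothesis Theta_contact : is_contact_form Theta.
Notation pt := 'rV[R]_3.
Implicit Types (g u v x : pt).

Lemma pairingE (w : 'cV[R]_3) v :
  pairing w v = v 0 0 * w 0 0 + v 0 1 * w 1 0 + v 0 2 * w 2 0.
Proof.
rewrite /pairing mxE !big_ord_recr big_ord0/= add0r.
by congr (_ * _ + _ * _ + _ * _); congr (fun_of_matrix _ _ _); apply: val_inj.
Qed.

Let differentiable_Theta g : differentiable Theta g.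
Proof. by have [+ _] := contact_smooth Theta_contact 1; exact. Qed.

(** [X1] and [X2] lie in the kernel, so Theta = tau (dt + (y dx - x dy) / 2), where tau is the
    dt-component and is still unknown. *)
Lemma contact_entries g : Theta g 0 0 = g 0 1 / 2 * Theta g 2 0 /\
  Theta g 1 0 = - (g 0 0 / 2) * Theta g 2 0.
Proof.
have := (contact_kernel Theta_contact g (X1 g)).2 (horizontal_X1 g).
have := (contact_kernel Theta_contact g (X2 g)).2 (horizontal_X2 g).
rewrite !pairingE; have [-> -> ->] := X1_entries g.
have [-> -> ->] := X2_entries g => h1 h2; split; lra.
Qed.

Lemma derive_contact g v :
  let tau x := Theta x 2 0 in
  ('D_v Theta g) 0 0 = v 0 1 / 2 * tau g + g 0 1 / 2 * 'D_v tau g /\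
  ('D_v Theta g) 1 0 = - (v 0 0 / 2) * tau g - g 0 0 / 2 * 'D_v tau g.
Proof.
move=> tau; have dtau : derivable tau g v.
  exact/diff_derivable/differentiable_entry.
have dcoord i : derivable (fun x : pt => x 0 i) g v.
  exact/diff_derivable/differentiable_coord.
rewrite !derive_entry//; split.
- rewrite (_ : (fun x => _) = 2^-1 \*: ((fun x : pt => x 0 1) * tau)).
    rewrite (deriveZ _ (derivableM (dcoord 1) dtau)).
    rewrite (deriveM (dcoord 1) dtau) derive_coord.
    by rewrite /GRing.scale/=; ring.
  apply/funext => x; rewrite (contact_entries x).1.
  by rewrite -[RHS]/(2^-1 * (x 0 1 * Theta x 2 0)); ring.
- rewrite (_ : (fun x => _) = (- 2^-1) \*: ((fun x : pt => x 0 0) * tau)).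
    rewrite (deriveZ _ (derivableM (dcoord 0) dtau)).
    rewrite (deriveM (dcoord 0) dtau) derive_coord.
    by rewrite /GRing.scale/=; ring.
  apply/funext => x; rewrite (contact_entries x).2.
  by rewrite -[RHS]/(- 2^-1 * (x 0 0 * Theta x 2 0)); ring.
Qed.

(** The terms containing the derivative of tau assemble into a multiple of [tcoord g v]. They
    therefore vanish for horizontal [v], and the normalization can fix tau before anything is known
    about its derivative. *)
Lemma pairing_derive_contact g u v :
  pairing ('D_u Theta g) v =
    Theta g 2 0 * (u 0 1 * v 0 0 - u 0 0 * v 0 1) / 2 +
    'D_u (fun x => Theta x 2 0) g * tcoord g v.
Proof.
have [D0 D1] := derive_contact g u.
rewrite pairingE D0 D1 (derive_entry _ _ _ (differentiable_Theta g)) /tcoord.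
by field.
Qed.

(** Since [J] sends [X1] to [X2], the Levi form of [X1] with itself is dTheta(X1, X2) / 2 = -tau /
    2, and this must be 1. *)
Lemma contact_t g : Theta g 2 0 = -2.
Proof.
have [+ _ _ _] := contact_normalized Theta_contact g.
rewrite /levi /dform; have [-> _ _] := J_frame g.
rewrite !pairing_derive_contact.
rewrite ((horizontalE g _).1 (horizontal_X1 g)).
rewrite ((horizontalE g _).1 (horizontal_X2 g)).
have [-> -> _] := X1_entries g; have [-> -> _] := X2_entries g.
rewrite !mulr0 !addr0; move: (Theta g 2 0) => t; lra.
Qed.

Lemma dform_contact g u v :
  dform Theta g u v = 2 * (u 0 0 * v 0 1 - u 0 1 * v 0 0).
Proof.
have Dt w : 'D_w (fun x => Theta x 2 0) g = 0.
  rewrite (_ : (fun _ => _) = cst (-2)) ?derive_cst//.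
  by apply/funext => x; exact: contact_t.
by rewrite /dform !pairing_derive_contact !Dt contact_t; field.
Qed.

(** Consequently the Levi form is the horizontal part of [metric], and unit length of a horizontal
    vector means the same on the Riemannian and on the CR side. *)
Lemma levi_contact g u v :
  levi Theta g u v = u 0 0 * v 0 0 + u 0 1 * v 0 1.
Proof. by rewrite /levi dform_contact; have [-> ->] := J_entries g v; field. Qed.

(** Contracting dTheta with [X2] and [X1] kills the first two components of [xi]; the value of Theta
    on [xi] then fixes the third. *)
Lemma reeb_contact xi g : is_reeb Theta xi -> xi g = - 2^-1 *: T g.
Proof.
move=> /(_ g)[xi1 xi0]; have := xi0 (X1 g); have := xi0 (X2 g).
rewrite !dform_contact; have [-> -> _] := X1_entries g.
have [-> -> _] := X2_entries g => h0 h1.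
have {}h0 : xi g 0 0 = 0 by lra.
have {}h1 : xi g 0 1 = 0 by lra.
move: xi1; rewrite pairingE h0 h1 contact_t => xi2.
apply: row3P; rewrite !mxE/=; lra.
Qed.

End Contact.

(** * Covariant derivatives of the frame and of nearly horizontal fields *)

Section Connections.
Context {R : realType}.
Notation pt := 'rV[R]_3.
Implicit Types (g u v x : pt) (nabla : covderiv (R := R)).

Lemma addrr_eq0 (a : R) : a + a = 0 -> a = 0.
Proof. lra. Qed.

Lemma derive_constant {V : normedModType R} (f : V -> R) c y w :
  (forall z, f z = c) -> 'D_w f y = 0.
Proof. by move=> fc; rewrite (_ : f = cst c) ?derive_cst//; apply/funext. Qed.

(** Both restrictions, to horizontal [v] and to the first two components, matter for the Levi-Civita
    connection: there nabla_X1 X2 = T / 2 and nabla_T X1 = -X2 / 2. *)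
Definition horizontally_flat_frame nabla := forall g v, horizontal g v ->
  (nabla g v (@X1 R) 0 0 = 0 /\ nabla g v (@X1 R) 0 1 = 0) /\
  (nabla g v (@X2 R) 0 0 = 0 /\ nabla g v (@X2 R) 0 1 = 0).

Lemma connection_comb nabla g a b u v Y : is_connection nabla ->
  Ck_near 1 g Y ->
  nabla g (a *: u + b *: v) Y = a *: nabla g u Y + b *: nabla g v Y.
Proof.
(* The linearity axiom has the form [a *: u + v]; homogeneity in the second term comes from the zero
   direction, where it reads n = n + n. *)
move=> nablaP Y1; have n0 : nabla g 0 Y = 0.
  have := connection_linear nablaP 1 0 0 Y1.
  by rewrite !scale1r addr0 => /esym/eqP; rewrite -subr_eq0 addrK => /eqP.
rewrite (connection_linear nablaP)//; congr (_ + _).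
by rewrite -[in LHS](addr0 (b *: v)) (connection_linear nablaP)// n0 addr0.
Qed.

(** By the skew-symmetry hypothesis the only unknown is omega(v), the [X2]-component of nabla_v X1.
    The [X1]-component of the torsion gives omega(X1) = 0, the [X2]-component gives omega(X2) = 0,
    and omega is linear in v. *)
Lemma koszul_horizontal nabla : is_connection nabla ->
  (forall g v, [/\ nabla g v (@X1 R) 0 0 = 0, nabla g v (@X2 R) 0 1 = 0 &
    nabla g v (@X1 R) 0 1 + nabla g v (@X2 R) 0 0 = 0]) ->
  (forall g, torsion nabla (@X1 R) (@X2 R) g 0 0 = 0 /\
    torsion nabla (@X1 R) (@X2 R) g 0 1 = 0) ->
  horizontally_flat_frame nabla.
Proof.
move=> nablaP met tor g v vh.
have [-> -> mv] := met g v.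
suff n12 : nabla g v (@X1 R) 0 1 = 0 by move: mv; rewrite n12 add0r => ->.
have [_ _ m1] := met g (X1 g); have [m2 _ _] := met g (X2 g).
have [_ m1' _] := met g (X1 g).
have [] := tor g; rewrite /torsion bracket_X1_X2 !mxE/= m1' m2 => t1 t2.
rewrite (horizontal_decomposition vh) connection_comb//; last exact: Ck_near1_X1.
have n11 : nabla g (X1 g) (@X1 R) 0 1 = 0 by lra.
have n21 : nabla g (X2 g) (@X1 R) 0 1 = 0 by lra.
by rewrite !mxE n11 n21 !mulr0 addr0.
Qed.

(** [F] is expanded in the full frame, because an extension of a horizontal field may leave the
    horizontal bundle off the surface. The Leibniz rule on the [T]-term yields one term with the
    derivative of [tcoord] and one with its value at [g]; both are zero, so the derivative of [T]
    drops out. *)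
Lemma flat_frame_derivative nabla g v (F : pt -> pt) :
  is_connection nabla -> horizontally_flat_frame nabla ->
  Ck_near 1 g F -> horizontal g v -> horizontal g (F g) ->
  'D_v (fun x => tcoord x (F x)) g = 0 ->
  nabla g v F 0 0 = 'D_v F g 0 0 /\ nabla g v F 0 1 = 'D_v F g 0 1.
Proof.
move=> nablaP flat F1 vh /horizontalE Fg DF.
have F1j j := Ck_near1_entry 0 j F1.
have c1 : Ck_near 1 g (fun x => tcoord x (F x)).
  rewrite (_ : (fun x => _) = fun x => F x 0 2 +
      (2^-1 * (x 0 1 * F x 0 0) + - 2^-1 * (x 0 0 * F x 0 1))).
    apply: Ck_near1D; first exact: F1j.
    apply: Ck_near1D; (apply: Ck_near1M; [exact: Ck_near1_cst|]);
      (apply: Ck_near1M; [exact: Ck_near1_coord|exact: F1j]).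
  by apply/funext => x; rewrite /tcoord; ring.
have T1 : Ck_near 1 g (@T R) by exact: Ck_near1_cst.
have X11 := Ck_near1_X1 g; have X21 := Ck_near1_X2 g.
have a1 := Ck_near1Z (F1j 0) X11; have b1 := Ck_near1Z (F1j 1) X21.
have -> : nabla g v F =
    'D_v (fun x => F x 0 0) g *: X1 g + F g 0 0 *: nabla g v (@X1 R) +
    ('D_v (fun x => F x 0 1) g *: X2 g + F g 0 1 *: nabla g v (@X2 R)).
  rewrite [in LHS](_ : F = fun x => F x 0 0 *: X1 x + F x 0 1 *: X2 x +
      tcoord x (F x) *: T x); last first.
    by apply/funext => x; exact: frame_decomposition.
  rewrite (connection_additive nablaP _ (Ck_near1D a1 b1) (Ck_near1Z c1 T1)).
  rewrite (connection_additive nablaP _ a1 b1).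
  rewrite (connection_leibniz nablaP _ (F1j 0) X11).
  rewrite (connection_leibniz nablaP _ (F1j 1) X21).
  by rewrite (connection_leibniz nablaP _ c1 T1) DF Fg !scale0r !addr0.
have dF := Ck_near1_differentiable F1.
rewrite !(derive_entry _ _ _ dF).
rewrite !mxE; have [[-> ->] [-> ->]] := flat g v vh.
by rewrite /= !(mulr0, mulr1, addr0, add0r).
Qed.

Lemma metricC g u v : metric g u v = metric g v u.
Proof. by rewrite /metric; ring. Qed.

Lemma dot_X1 g u : u 0 0 * X1 g 0 0 + u 0 1 * X1 g 0 1 = u 0 0.
Proof. by have [-> -> _] := X1_entries g; rewrite mulr1 mulr0 addr0. Qed.

Lemma dot_X2 g u : u 0 0 * X2 g 0 0 + u 0 1 * X2 g 0 1 = u 0 1.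
Proof. by have [-> -> _] := X2_entries g; rewrite mulr1 mulr0 add0r. Qed.

Lemma metric_X1r g u : metric g u (X1 g) = u 0 0.
Proof. by rewrite (metric_horizontal _ (horizontal_X1 g)) dot_X1. Qed.

Lemma metric_X2r g u : metric g u (X2 g) = u 0 1.
Proof. by rewrite (metric_horizontal _ (horizontal_X2 g)) dot_X2. Qed.

(** Differentiating the constant products of [X1] and [X2] gives the skew-symmetry required by
    [koszul_horizontal]; the torsion vanishes outright. *)
Lemma levi_civita_flat_frame nabla :
  is_levi_civita nabla -> horizontally_flat_frame nabla.
Proof.
move=> [nablaP tor met]; apply: koszul_horizontal => //= [g v|g]; last first.
  rewrite tor ?mxE//; [exact: Ck_near1_X1|exact: Ck_near1_X2].
have X11 := Ck_near1_X1 g; have X21 := Ck_near1_X2 g.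
have D11 : 'D_v (fun x => metric x (X1 x) (X1 x)) g = 0.
  by apply: (derive_constant (c := 1)) => x; have [[]] := metric_orthonormal x.
have D22 : 'D_v (fun x => metric x (X2 x) (X2 x)) g = 0.
  by apply: (derive_constant (c := 1)) => x; have [[]] := metric_orthonormal x.
have D12 : 'D_v (fun x => metric x (X1 x) (X2 x)) g = 0.
  by apply: (derive_constant (c := 0)) => x; have [_ []] := metric_orthonormal x.
have := etrans (esym (met g v _ _ X11 X11)) D11.
rewrite metric_X1r metricC metric_X1r => m11.
have := etrans (esym (met g v _ _ X21 X21)) D22.
rewrite metric_X2r metricC metric_X2r => m22.
have := etrans (esym (met g v _ _ X11 X21)) D12.
rewrite metric_X2r metricC metric_X1r => m12.
by split; [exact: addrr_eq0|exact: addrr_eq0|].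
Qed.

Lemma C1_horizontal_near_X1 g : C1_horizontal_near g (@X1 R).
Proof. by split; [exact: Ck_near1_X1|near=> x; exact: horizontal_X1].
Unshelve. all: by end_near. Qed.

Lemma C1_horizontal_near_X2 g : C1_horizontal_near g (@X2 R).
Proof. by split; [exact: Ck_near1_X2|near=> x; exact: horizontal_X2].
Unshelve. all: by end_near. Qed.

(** The same argument with the Levi form in place of the metric. The torsion of the frame is now a
    multiple of the Reeb field, whose first two components are zero. *)
Lemma tanaka_webster_flat_frame Theta nabla :
  is_contact_form Theta -> is_tanaka_webster Theta nabla ->
  horizontally_flat_frame nabla.
Proof.
move=> TP [xi xiP twP]; have X1h := C1_horizontal_near_X1.
have X2h := C1_horizontal_near_X2.
apply: koszul_horizontal => [|g v|g]; first exact: (tw_connection twP).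
- have D11 : 'D_v (fun x => levi Theta x (X1 x) (X1 x)) g = 0.
    by apply: (derive_constant (c := 1)) => x; have [] := contact_normalized TP x.
  have D22 : 'D_v (fun x => levi Theta x (X2 x) (X2 x)) g = 0.
    by apply: (derive_constant (c := 1)) => x; have [] := contact_normalized TP x.
  have D12 : 'D_v (fun x => levi Theta x (X1 x) (X2 x)) g = 0.
    by apply: (derive_constant (c := 0)) => x; have [] := contact_normalized TP x.
  have leviX1r u : levi Theta g u (X1 g) = u 0 0.
    by rewrite (levi_contact TP) dot_X1.
  have leviX2r u : levi Theta g u (X2 g) = u 0 1.
    by rewrite (levi_contact TP) dot_X2.
  have leviC u w : levi Theta g u w = levi Theta g w u.
    by rewrite !(levi_contact TP) [X in X + _]mulrC [X in _ + X]mulrC.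
  have := etrans (esym (tw_levi twP v (X1h g) (X1h g))) D11.
  rewrite leviX1r leviC leviX1r => m11.
  have := etrans (esym (tw_levi twP v (X2h g) (X2h g))) D22.
  rewrite leviX2r leviC leviX2r => m22.
  have := etrans (esym (tw_levi twP v (X1h g) (X2h g))) D12.
  rewrite leviX2r leviC leviX1r => m12.
  by split; [exact: addrr_eq0|exact: addrr_eq0|].
- rewrite (tw_torsion_horizontal twP (X1h g) (X2h g)) (reeb_contact TP _ xiP).
  by rewrite !mxE/= !mulr0.
Qed.

End Connections.

(** * Tangential derivatives and independence of the chosen extension *)

Section Surfaces.
Context {R : realType} (S : set 'rV[R]_3).
Notation pt := 'rV[R]_3.
Implicit Types (g u v x : pt) (nabla : covderiv (R := R)).

(** By the chain rule both sides are derivatives at 0 of compositions with a curve in [S] of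
    velocity [v], and these compositions agree near 0. *)
Lemma derive_tangent {Y : normedModType R} (F G : pt -> Y) g v :
  tangent S g v -> differentiable F g -> differentiable G g ->
  (\forall x \near g, S x -> F x = G x) -> 'D_v F g = 'D_v G g.
Proof.
move=> [gamma [g0 Sg dgamma]] dF dG FG.
have dg : differentiable gamma 0.
  by apply/derivable1_diffP; exact: ex_derive.
have chain (H : pt -> Y) : differentiable H g -> 'D_1 (H \o gamma) 0 = 'D_v H g.
  move=> dH; rewrite deriveE; last by apply: differentiable_comp; rewrite ?g0.
  rewrite diff_comp ?g0//= -deriveE//.
  by rewrite -(@deriveE _ _ _ gamma)// derive_val.
rewrite -!chain//; apply: near_eq_derive.
have gammaFG : \forall s \near (0 : R), S (gamma s) -> F (gamma s) = G (gamma s).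
  by have := differentiable_continuous dg; rewrite /prop_for /continuous_at g0 => /(_ _ FG).
by apply: filterS2 Sg gammaFG => s Ss; apply.
Qed.

Context (N : pt -> pt).
Hypothesis N_normal : is_normal S N.
Let A := noncharacteristic S N.

Lemma p_entry x : p N x = N x 0 0.
Proof. exact: metric_X1r. Qed.

Lemma q_entry x : q N x = N x 0 1.
Proof. exact: metric_X2r. Qed.

(** Replaces the square root in [W] by a polynomial in the entries of [N], whose positivity is an
    open condition. *)
Lemma noncharacteristicE x :
  A x <-> S x /\ 0 < N x 0 0 ^+ 2 + N x 0 1 ^+ 2.
Proof.
rewrite /A /noncharacteristic /characteristic /setD/= /W p_entry q_entry.
split=> [[Sx h]|[Sx h]]; split=> //.
  by rewrite ltNge; apply/negP => h0; apply: h; split=> //; apply/eqP; rewrite sqrtr_eq0.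
by move=> [_ /eqP]; rewrite sqrtr_eq0 leNgt h.
Qed.

Lemma W_gt0 x : A x -> 0 < W N x.
Proof. by move=> /noncharacteristicE[_]; rewrite /W p_entry q_entry sqrtr_gt0. Qed.

(** Relative openness in [S]: identities known on the noncharacteristic set then hold on all of [S]
    near [g], as [derive_tangent] requires. *)
Lemma noncharacteristic_near g :
  A g -> \forall x \near g, S x -> A x.
Proof.
move=> /noncharacteristicE[Sg Ng].
have [NF [NF1 NFN]] := normal_C1 N_normal Sg.
have cN : {for g, continuous (fun x => NF x 0 0 * NF x 0 0 + NF x 0 1 * NF x 0 1)}.
  have dNF j := differentiable_entry 0 j (Ck_near1_differentiable NF1).
  apply: differentiable_continuous.
  by apply: differentiableD; apply: differentiableM.
have := nbhs_singleton NFN Sg => NFg.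
have NF0 : 0 < NF g 0 0 * NF g 0 0 + NF g 0 1 * NF g 0 1.
  by rewrite NFg -!expr2.
apply: filterS2 NFN (cN _ (lt_nbhsr NF0)) => x NFx {}NF0 Sx; apply/noncharacteristicE; split=> //.
by rewrite -(NFx Sx) !expr2.
Qed.

Lemma cov_along_flat_frame nabla (Y F : pt -> pt) g v :
  is_connection nabla -> horizontally_flat_frame nabla ->
  (forall x, A x -> horizontal x (Y x)) -> A g ->
  tangent S g v -> horizontal g v -> C1_extension A Y g F ->
  cov_along nabla A Y g v 0 0 = 'D_v F g 0 0 /\
  cov_along nabla A Y g v 0 1 = 'D_v F g 0 1.
Proof.
move=> nablaP flat Yh Ag vt vh FY; rewrite /cov_along.
(* The default value 0 of [xget] is excluded because [F] is an admissible extension. The extension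
   [F'] actually selected may differ from [F]. *)
have [|F' [[F'1 F'Y] ->]] := @xgetPex _ 0
    [set w | exists F', C1_extension A Y g F' /\ w = nabla g v F'].
  by exists (nabla g v F), F.
have [F1 {}FY] := FY; have SA := noncharacteristic_near Ag.
have F'h : \forall x \near g, S x -> tcoord x (F' x) = 0.
  apply: filterS2 SA F'Y => x SAx F'Yx Sx; apply/horizontalE.
  by rewrite F'Yx; [apply: Yh|]; exact: SAx.
(* Both extensions equal [Y] on [S] near [g], and [v] is tangent. *)
have -> : 'D_v F g = 'D_v F' g.
  apply: derive_tangent => //; try exact: Ck_near1_differentiable.
  apply: filterS3 SA F'Y FY => x SAx F'Yx FYx Sx.
  by rewrite F'Yx ?FYx//; exact: SAx.
have Sg : S g by case: Ag.
apply: flat_frame_derivative => //; first exact/horizontalE/(nbhs_singleton F'h).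
(* The [T]-coordinate of [F'] vanishes on [S] near [g], hence has the same tangential derivative as
   the constant 0. *)
rewrite (@derive_tangent _ _ (cst 0) _ _ vt) ?derive_cst//.
have dF' j := differentiable_entry 0 j (Ck_near1_differentiable F'1).
have dcoord j : differentiable (fun x : pt => x 0 j) g by exact: differentiable_coord.
rewrite /tcoord; apply: differentiableD; first exact: dF'.
apply: differentiableM; last exact: differentiable_cst.
by apply: differentiableB; apply: differentiableM.
Qed.

End Surfaces.

(** Reparametrize the curve by s -> a s; this carries tangency over from [e1] to its multiple
    [e]. *)
Lemma tangentZ {R : realType} (S : set 'rV[R]_3) g v (a : R) :
  tangent S g v -> tangent S g (a *: v).
Proof.
move=> [gamma [g0 Sg dgamma]]; pose h (s : R) : R := a *: s.
have dg : differentiable gamma 0.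
  by apply/derivable1_diffP; exact: ex_derive.
have [dh hE] := is_diff_scaler a (0 : R^o).
have h0 : h 0 = 0 by exact: scaler0.
have dga : differentiable (gamma \o h) 0.
  by apply: differentiable_comp; rewrite ?h0.
exists (gamma \o h); split; first by rewrite /= h0.
  have /= := differentiable_continuous dh.
  by rewrite /prop_for /continuous_at scaler0 => /(_ _ Sg).
apply: DeriveDef; first exact: diff_derivable.
rewrite deriveE// diff_comp ?h0//= [X in 'd gamma 0 X](_ : _ = a *: 1).
  by rewrite linearZ/= -deriveE// derive_val.
by rewrite hE.
Qed.

(** * The sign relating the unit section [e1] to the field [e] *)

Section UnitSection.
Context {R : realType} (S : set 'rV[R]_3) (N : 'rV[R]_3 -> 'rV[R]_3).
Context (Theta : 'rV[R]_3 -> 'cV[R]_3) (e1 : 'rV[R]_3 -> 'rV[R]_3).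
Hypothesis N_normal : is_normal S N.
Hypothesis Theta_contact : is_contact_form Theta.
Hypothesis e1_section : is_unit_section S N Theta e1.
Let A := noncharacteristic S N.
Notation pt := 'rV[R]_3.
Implicit Types (g x : pt).

(** At noncharacteristic points this is the inner product of [e1] and [e], written through the
    entries of [e1] and [N] so that its continuity is visible. *)
Definition orientation x : R :=
  (e1 x 0 0 * N x 0 1 - e1 x 0 1 * N x 0 0) / W N x.

Lemma section_orthonormal x : A x ->
  e1 x 0 0 ^+ 2 + e1 x 0 1 ^+ 2 = 1 /\
  N x 0 0 * e1 x 0 0 + N x 0 1 * e1 x 0 1 = 0.
Proof.
move=> Ax; have [te he] := section_HTS e1_section Ax; split.
  by have := section_unit e1_section Ax; rewrite levi_contact// !expr2.
by rewrite -(metric_horizontal _ he); exact: (normal_orthogonal N_normal te).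
Qed.

Lemma W_sqr x : W N x ^+ 2 = N x 0 0 ^+ 2 + N x 0 1 ^+ 2.
Proof. by rewrite /W sqr_sqrtr ?p_entry ?q_entry// addr_ge0// sqr_ge0. Qed.

(** In the horizontal plane [e] and the unit vector [e1] are both orthogonal to (p, q), so [e]
    equals its projection onto [e1]. *)
Lemma orientation_e1 x : A x ->
  orientation x * e1 x 0 0 = qbar N x /\
  orientation x * e1 x 0 1 = - pbar N x.
Proof.
move=> Ax; have [unit orth] := section_orthonormal Ax.
rewrite /orientation /qbar /pbar p_entry q_entry.
move: (e1 x 0 0) (e1 x 0 1) (N x 0 0) (N x 0 1) (W N x)^-1 unit orth.
move=> a b p q w ab1 ab0; split.
  (* Isolates the two known quantities, the squared length of [e1] and its product with the
     normal. *)
  transitivity ((a ^+ 2 + b ^+ 2) * q * w - b * w * (p * a + q * b)); first by ring.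
  by rewrite ab1 ab0 mulr0 subr0 mul1r.
transitivity (a * w * (p * a + q * b) - (a ^+ 2 + b ^+ 2) * p * w); first by ring.
by rewrite ab1 ab0 mulr0 sub0r mul1r.
Qed.

Lemma e_orientation x : A x -> e N x = orientation x *: e1 x.
Proof.
move=> Ax; have [_ he] := section_HTS e1_section Ax.
have [ha hb] := orientation_e1 Ax.
by rewrite (horizontal_decomposition he) scalerDr !scalerA ha hb scaleNr.
Qed.

Lemma orientation_sqr x : A x -> orientation x ^+ 2 = 1.
Proof.
move=> Ax; have [unit _] := section_orthonormal Ax.
have [ha hb] := orientation_e1 Ax.
rewrite -[LHS]mulr1 -unit mulrDr -!exprMn ha hb sqrrN /qbar /pbar !exprMn -mulrDl.
rewrite p_entry q_entry addrC -W_sqr -exprMn mulfV ?expr1n//.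
by rewrite gt_eqF//; exact: W_gt0 Ax.
Qed.

Lemma orientation_sign x : A x -> orientation x = 1 \/ orientation x = -1.
Proof. by move=> /orientation_sqr/eqP; rewrite sqrf_eq1 => /orP[]/eqP; auto. Qed.

(** A sign that varies continuously is locally constant. Since [e1] and [N] are C^1 only through
    extensions, continuity is applied to [D], built from the extensions and defined on the whole
    space. *)
Lemma orientation_near g :
  A g -> \forall x \near g, A x -> orientation x = orientation g.
Proof.
move=> Ag; have Sg : S g by case: Ag.
have [F [F1 Fe]] := section_C1 e1_section Ag.
have [G [G1 GN]] := normal_C1 N_normal Sg.
pose D x := (F x 0 0 * G x 0 1 - F x 0 1 * G x 0 0) * orientation g.
have cD : {for g, continuous D}.
  have dF j := differentiable_entry 0 j (Ck_near1_differentiable F1).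
  have dG j := differentiable_entry 0 j (Ck_near1_differentiable G1).
  apply: differentiable_continuous; apply: differentiableM => //.
  by apply: differentiableB; apply: differentiableM.
have DE x : A x -> F x = e1 x -> G x = N x ->
    D x = orientation x * orientation g * W N x.
  move=> Ax Fx Gx; rewrite /D Fx Gx /orientation [RHS]mulrAC divfK//.
  by rewrite gt_eqF//; exact: W_gt0 Ax.
(* At [g] the two signs multiply to 1, leaving [W N g]. Positivity persists near [g], and on the
   noncharacteristic set it forces the signs at [x] and [g] to agree. *)
have Dg : 0 < D g.
  rewrite (DE _ Ag (nbhs_singleton Fe Ag) (nbhs_singleton GN Sg)).
  by rewrite -expr2 orientation_sqr// mul1r; exact: W_gt0 Ag.
apply: filterS3 Fe GN (cD _ (lt_nbhsr Dg)) => x Fx Gx Dx Ax.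
have Sx : S x by case: Ax.
move: Dx; rewrite /= (DE _ Ax (Fx Ax) (Gx Sx)) pmulr_lgt0; last exact: W_gt0 Ax.
by case: (orientation_sign Ax) (orientation_sign Ag) => -> [] -> //; lra.
Qed.

End UnitSection.

(** * Comparison of the two mean curvatures *)

Theorem proposition9p14 (R : realType) (S : set 'rV[R]_3)
    (N : 'rV[R]_3 -> 'rV[R]_3) (nablaLC nablaPH : covderiv (R := R))
    (Theta : 'rV[R]_3 -> 'cV[R]_3) (e1 : 'rV[R]_3 -> 'rV[R]_3)
    (Hph : 'rV[R]_3 -> R) :
  C2_surface S ->
  is_normal S N ->
  is_levi_civita nablaLC ->
  is_contact_form Theta ->
  is_tanaka_webster Theta nablaPH ->
  is_unit_section S N Theta e1 ->
  is_ph_mean_curvature S N nablaPH e1 Hph ->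
  exists s : 'rV[R]_3 -> R,
    locally_constant_sign (noncharacteristic S N) s /\
    (forall g, noncharacteristic S N g ->
      Hph g = s g * H_mean_curvature S N nablaLC g).
Proof.
(* Rotation by [J] sends [e] to [nuH], so it sends [e1] to [nuH] times the orientation; the minus
   sign is the one in the definition of [H_mean_curvature]. *)
move=> _ nN lc cT tw us ph; exists (fun x => - orientation N e1 x); split=> g Ag.
  split; first by case: (orientation_sign nN cT us Ag) => ->; rewrite ?opprK; auto.
  by apply: filterS (orientation_near nN cT us Ag) => x ox /ox ->.
have [te he] := section_HTS us Ag.
have eE := e_orientation nN cT us.
have [ha hb] := orientation_e1 nN cT us Ag.
have o2 := orientation_sqr nN cT us Ag.
set o := orientation N e1 in ha hb o2 eE *.
have eh x : noncharacteristic S N x -> horizontal x (e N x).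
  by move=> _; exists (qbar N x), (- pbar N x); rewrite scaleNr.
have et : tangent S g (e N g).
  by rewrite (eE _ Ag); exact: tangentZ.
have [F [F1 Fe]] := section_C1 us Ag.
(* The sign is frozen at its value at [g], which is legitimate near [g] because it is locally
   constant along the noncharacteristic set. *)
have Ge : C1_extension (noncharacteristic S N) (e N) g (fun x => o g *: F x).
  split; first by apply: Ck_near1Z => //; exact: Ck_near1_cst.
  apply: filterS2 Fe (orientation_near nN cT us Ag) => x Fx ox Ax.
  by rewrite (eE _ Ax) Fx// /o ox.
have [xi _ tw'] := tw.
have [p0 p1] := cov_along_flat_frame nN (tw_connection tw')
  (tanaka_webster_flat_frame cT tw) (fun x Ax => (section_HTS us Ax).2) Ag te he
  (conj F1 Fe).
have [l0 l1] := cov_along_flat_frame nN (levi_civita_connection lc)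
  (levi_civita_flat_frame lc) eh Ag et (eh _ Ag) Ge.
have dF := Ck_near1_differentiable F1.
(* The sign enters once through the direction and once through the field, and its square is 1. *)
have DG : 'D_(e N g) (fun x => o g *: F x) g = 'D_(e1 g) F g.
  rewrite (eE _ Ag) deriveZ; last exact: diff_derivable.
  by rewrite !deriveE// linearZ scalerA -expr2 o2 scale1r.
have hnu : horizontal g (nuH N g) by exists (pbar N g), (qbar N g).
have nu0 : nuH N g 0 0 = pbar N g by rewrite /nuH !mxE/= mulr1 mulr0 addr0.
have nu1 : nuH N g 0 1 = qbar N g by rewrite /nuH !mxE/= mulr1 mulr0 add0r.
rewrite /H_mean_curvature (metric_horizontal _ hnu) l0 l1 DG -p0 -p1 nu0 nu1.
have [J0 J1] := J_entries g (e1 g).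
have scale_entry (k : R) (u : 'rV[R]_3) j : (k *: u) 0 j = k * u 0 j by rewrite mxE.
rewrite (ph _ Ag) !scale_entry J0 J1.
have [unit _] := section_orthonormal nN cT us Ag.
(* With [pbar] and [qbar] expressed through [e1] and the sign, the claim becomes a polynomial
   identity modulo a^2 + b^2 = 1 and c^2 = 1. *)
rewrite -ha -[pbar N g]opprK -hb.
move: (e1 g 0 0) (e1 g 0 1) (o g) (Hph g) unit o2 => a b c k ab1 c1.
transitivity (k * c ^+ 2 * (a ^+ 2 + b ^+ 2)); first by rewrite c1 ab1 !mulr1.
by ring.
Qed.
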